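(* Let $X$ be a computably compact computable metric space. Then $\mathrm{MAX}_X \equiv_{\mathrm{W}} \mathrm{Z}_X$, i.e. $\mathrm{MAX}_X$ and $\mathrm{Z}_X$ are Weihrauch equivalent, where $\mathrm{MAX}_X :\subseteq \mathcal{C}(X)\rightrightarrows X$, $f\mapsto \{x\in X : f(x)=\max f(X)\}$ (defined on all of $\mathcal{C}(X)$), and $\mathrm{Z}_X :\subseteq \mathcal{C}(X)\rightrightarrows X$, $f\mapsto f^{-1}\{0\}$, with domain the set of continuous $f$ that have at least one zero.
   Context: A computable metric space is a metric space $(X,d)$ together with a dense sequence $(a_n)_n$ in $X$ such that the double sequence of real numbers $(d(a_i,a_j))_{i,j}$ is computable; points of $X$ are represented by fast converging Cauchy sequences from $(a_n)_n$ (Cauchy representation). Computably compact is meant in the standard sense of computable analysis (compact, with the set of finite covers by rational open balls centred at points $a_n$ being computably enumerable). $\mathcal{C}(X)$ denotes the space of continuous functions $f:X\to\mathbb{R}$ with its standard representation (inducing the compact-open topology). For partial multi-valued functions $f:\subseteq A\rightrightarrows B$ and $g:\subseteq C\rightrightarrows D$ on represented spaces, $f$ is Weihrauch reducible to $g$, written $f\le_{\mathrm W} g$, if there are computable multi-valued functions $H,K$ such that $\emptyset\neq H(x,gK(x))\subseteq f(x)$ for all $x\in\mathrm{dom}(f)$; $f\equiv_{\mathrm W} g$ means $f\le_{\mathrm W} g$ and $g\le_{\mathrm W} f$. *)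

(* Defs.v *)
From HB Require Import structures.
From mathcomp Require Import all_boot all_order all_algebra.
From mathcomp Require Import all_classical all_reals all_analysis.

Set Implicit Arguments.
Unset Strict Implicit.
Unset Printing Implicit Defensive.

Import Order.TTheory GRing.Theory Num.Theory.
Import numFieldNormedType.Exports.

Local Open Scope classical_set_scope.
Local Open Scope ring_scope.

(* Partial recursive functions relative to an oracle.  Programs act on finite
   argument lists; absent arguments are read as 0. *)
Inductive prog : Type :=
| Zero
| Succ
| Proj of nat
| Oracle
| Comp of prog & seq prog
| PrimRec of prog & prog
| Mu of prog.

(* [prog_eval o e xs y]: with oracle [o], [e] halts on [xs] with value [y]. *)
Fixpoint prog_eval (o : nat -> nat) (e : prog) (xs : seq nat) (y : nat)
    {struct e} : Prop :=
  match e with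
  | Zero => y = 0%N
  | Succ => y = (nth 0%N xs 0).+1
  | Proj i => y = nth 0%N xs i
  | Oracle => y = o (nth 0%N xs 0)
  | Comp f gs => exists ys,
      (fix evals (gs : seq prog) (ys : seq nat) {struct gs} : Prop :=
         match gs, ys with
         | [::], [::] => True
         | g :: gs', z :: zs => prog_eval o g xs z /\ evals gs' zs
         | _, _ => False
         end) gs ys /\ prog_eval o f ys y
  | PrimRec f g =>
      (fix rec (n : nat) (y : nat) {struct n} : Prop :=
         match n with
         | 0 => prog_eval o f (behead xs) y
         | m.+1 => exists z,
             rec m z /\ prog_eval o g [:: m, z & behead xs] y
         end) (nth 0%N xs 0) y
  | Mu f => prog_eval o f (y :: xs) 0%N /\
      forall m, (m < y)%N -> exists z, prog_eval o f (m :: xs) z.+1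
  end.

Definition computes (e : prog) (p q : nat -> nat) : Prop :=
  forall n, prog_eval p e [:: n] (q n).

Definition computable_fun (g : nat -> nat) : Prop :=
  exists e, computes e (fun=> 0%N) g.

Definition comp_enumerable (A : set nat) : Prop :=
  A = set0 \/ exists2 g, computable_fun g & A = range g.

Record repSpace := RepSpace {
  rep_car :> Type ;
  is_name : (nat -> nat) -> rep_car -> Prop ;
  is_name_fun : forall p x y, is_name p x -> is_name p y -> x = y ;
  is_name_surj : forall x, exists p, is_name p x }.

Lemma prod_name_fun (A B : repSpace) (p : nat -> nat) (x y : A * B) :
  is_name (fun n => p n.*2) x.1 /\ is_name (fun n => p n.*2.+1) x.2 ->
  is_name (fun n => p n.*2) y.1 /\ is_name (fun n => p n.*2.+1) y.2 ->
  x = y.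
Proof.
case: x y => [a b] [a' b'] /= [pa pb] [pa' pb'].
by rewrite (is_name_fun pa pa') (is_name_fun pb pb').
Qed.

Lemma prod_name_surj (A B : repSpace) (x : A * B) : exists p : nat -> nat,
  is_name (fun n => p n.*2) x.1 /\ is_name (fun n => p n.*2.+1) x.2.
Proof.
have [p px] := is_name_surj x.1; have [q qx] := is_name_surj x.2.
exists (fun n => if odd n then q n./2 else p n./2); split.
  by under [X in is_name X _]eq_fun do rewrite odd_double doubleK.
by under [X in is_name X _]eq_fun do rewrite /= odd_double /= uphalf_double.
Qed.

Definition prod_space (A B : repSpace) : repSpace :=
  RepSpace (@prod_name_fun A B) (@prod_name_surj A B).

(* A partial multi-valued function; it is defined where its value is a
   nonempty set. *)
Definition mfun (A B : Type) := A -> set B.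

Definition mdom (A B : Type) (f : mfun A B) : set A := [set x | f x !=set0].

(* dom (g o f) = {x in dom f | f x is a subset of dom g} *)
Definition mcomp (A B C : Type) (g : mfun B C) (f : mfun A B) : mfun A C :=
  fun x => [set z | f x `<=` mdom g /\ exists2 y, f x y & g y z].

Definition mgraph (A B : Type) (f : mfun A B) : mfun A (A * B) :=
  fun x => [set z | z.1 = x /\ f x z.2].

Definition mcomputable (A B : repSpace) (f : mfun A B) : Prop :=
  exists e, forall p x, is_name p x -> mdom f x ->
    exists q, computes e p q /\ exists2 y, is_name q y & f x y.

Definition weihrauch_le (A B C D : repSpace) (f : mfun A B) (g : mfun C D) :=
  exists (H : mfun (prod_space A D) B) (K : mfun A C),
    [/\ mcomputable H, mcomputable K &
      forall x, mdom f x ->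
        let HgK := mcomp H (mgraph (mcomp g K)) x in
        HgK !=set0 /\ HgK `<=` f x].

Definition weihrauch_equiv (A B C D : repSpace) (f : mfun A B) (g : mfun C D) :=
  weihrauch_le f g /\ weihrauch_le g f.

Section cauchy_representation.
Context {R : realType} {M : metricType R} (a : nat -> M).
Import metricType_numDomainType.

Definition cauchy_name (p : nat -> nat) (x : M) : Prop :=
  (forall i j, (i < j)%N -> mdist (a (p i)) (a (p j)) <= 2 ^- i) /\
  a (p n) @[n --> \oo] --> x.

Lemma cauchy_name_fun p x y : cauchy_name p x -> cauchy_name p y -> x = y.
Proof.
move=> [_ px] [_ py]; exact: (cvg_unique (@metric_hausdorff _ M) px py).
Qed.

Lemma cauchy_name_dist p x i : cauchy_name p x -> mdist (a (p i)) x <= 2 ^- i.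
Proof.
move=> [pc px]; apply/ler_addgt0Pl => e e0.
have /cvgrPdist_lt/(_ _ e0)[N _ Nx] := px.
have := Nx (maxn N i.+1) (leq_maxl _ _) => /= Nxe.
rewrite addrC (le_trans (metric_triangle _ (a (p (maxn N i.+1))) _))// lerD//.
  by apply: pc; rewrite leq_max leqnn orbT.
by rewrite metric_sym ltW.
Qed.

Lemma exp2V_lt (e : R) : 0 < e -> exists n, 2 ^- n < e.
Proof.
move=> e0; exists (Num.truncn e^-1).+1.
rewrite -[ltRHS]invrK ltf_pV2 ?posrE ?invr_gt0 ?exprn_gt0//.
rewrite (lt_le_trans (truncnS_gt _))// -natrX ler_nat.
by rewrite ltnW// ltn_expl.
Qed.

Lemma dense_mdist : dense (range a) ->
  forall x (e : R), 0 < e -> exists n, mdist (a n) x < e.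
Proof.
move=> da x e e0; have [||y [/= + [n _ ny]]] := da (ball x e)^°.
- by exists x; exact: nbhsx_ballx.
- exact: open_interior.
move=> /interior_subset; rewrite ballEmdist/= => xy.
by exists n; rewrite ny metric_sym.
Qed.

Lemma exp2V_half i : 2 ^- i.+1 + 2 ^- i.+1 = 2 ^- i :> R.
Proof. by rewrite [RHS]splitr exprS invfM mulrC. Qed.

Lemma exp2V_le i j : (i <= j)%N -> 2 ^- j <= 2 ^- i :> R.
Proof. by move=> ij; rewrite lef_pV2 ?posrE ?exprn_gt0// ler_eXn2l// ltr1n. Qed.

Lemma exp2V_gt0 i : 0 < 2 ^- i :> R.
Proof. by rewrite invr_gt0 exprn_gt0. Qed.

Lemma cauchy_name_approx p x :
  (forall i, mdist (a (p i)) x <= 2 ^- i.+1) -> cauchy_name p x.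
Proof.
move=> ph; split=> [i j ij|].
  rewrite (le_trans (metric_triangle _ x _))// -exp2V_half lerD//.
  by rewrite metric_sym (le_trans (ph j))// exp2V_le// ltnS ltnW.
apply/cvgrPdist_lt => e /exp2V_lt[n ne]; exists n => // m /= nm.
rewrite metric_sym (le_lt_trans _ ne)// (le_trans (ph m))// exp2V_le//.
by rewrite (leq_trans nm).
Qed.

Lemma cauchy_name_surj : dense (range a) -> forall x, exists p, cauchy_name p x.
Proof.
move=> da x; have h i := dense_mdist da x (exp2V_gt0 i.+1).
have [p ph] := choice h; exists p; apply: cauchy_name_approx => i.
exact/ltW/ph.
Qed.

Definition cauchy_space (da : dense (range a)) : repSpace :=
  RepSpace cauchy_name_fun (cauchy_name_surj da).

End cauchy_representation.

(* The rational number (u - v) / (w + 1) coded by the list [u; v; w]. *)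
Definition nu_rat (R : realType) (n : nat) : R^o :=
  let s := CodeSeq.decode n in
  ((nth 0%N s 0)%:R - (nth 0%N s 1)%:R) / (nth 0%N s 2).+1%:R.

Definition pos_rat (R : realType) (u v : nat) : R := u.+1%:R / v.+1%:R.

Lemma nu_rat_dense (R : realType) : dense (range (@nu_rat R)).
Proof.
move=> O [x Ox] oO; have /nbhs_ballP[e /= e0 eO] : nbhs x O.
  by rewrite nbhsE; exists O.
have [|q] := @rat_in_itvoo R x (x + e); first by rewrite ltrDl.
rewrite in_itv/= => /andP[xq qe]; exists (ratr q); split.
  apply: eO; rewrite /ball/= ltr_distlC; apply/andP; split => //.
  by rewrite (lt_trans _ xq)// ltrBlDr ltrDl.
pose u := `|numq q|%N; pose d := `|denq q|%N.
exists (CodeSeq.code [:: (if numq q is Posz _ then u else 0);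
   (if numq q is Posz _ then 0 else u); d.-1]) => //.
rewrite /nu_rat CodeSeq.codeK/= prednK; last by rewrite absz_gt0 denq_neq0.
rewrite /ratr; congr (_ / _); last by rewrite -[denq q]absz_denq.
by rewrite /u; case: (numq q) => m /=; rewrite ?NegzE ?subr0// sub0r mulrNz.
Qed.

Definition real_space (R : realType) : repSpace :=
  cauchy_space (@nu_rat_dense R).

Definition computable_double_seq (R : realType) (s : nat -> nat -> R) : Prop :=
  exists e, forall i j n, exists2 y,
    prog_eval (fun=> 0%N) e [:: i; j; n] y & `|s i j - nu_rat R y| <= 2 ^- n.

Record computableMetric (R : realType) := ComputableMetric {
  cms_car :> metricType R ;
  cms_seq : nat -> cms_car ;
  cms_dense : dense (range cms_seq) ;
  cms_computable :
    computable_double_seq (fun i j => mdist (cms_seq i) (cms_seq j)) }.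

Definition cms_space (R : realType) (X : computableMetric R) : repSpace :=
  cauchy_space (@cms_dense R X).

(* A rational open ball is coded by [c; u; v]: center a_c and radius
   (u + 1) / (v + 1). *)
Definition coded_ball (R : realType) (X : computableMetric R) (b : nat) :
    set X :=
  let s := CodeSeq.decode b in
  ball (cms_seq X (nth 0%N s 0)) (pos_rat R (nth 0%N s 1) (nth 0%N s 2)).
Arguments coded_ball {R} X b _.

Definition coded_covers (R : realType) (X : computableMetric R) : set nat :=
  [set n | forall x : X, exists2 b,
     b \in CodeSeq.decode n & coded_ball X b x].

Definition computably_compact (R : realType) (X : computableMetric R) : Prop :=
  compact [set: X] /\ comp_enumerable (coded_covers X).

(* Application in Kleene's second algebra: [p] encodes a continuous partial
   function on Baire space, sending [q] to [r].  The value [r n] is read off at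
   the shortest prefix [w] of [q] on which [p] answers the query [n :: w];
   an answer is [(r n).+1], whereas 0 asks for a longer prefix. *)
Definition kleene_app (p q r : nat -> nat) : Prop :=
  forall n, exists m,
    p (CodeSeq.code (n :: mkseq q m)) = (r n).+1 /\
    forall k, (k < m)%N -> p (CodeSeq.code (n :: mkseq q k)) = 0%N.

Section continuous_functions.
Context {R : realType} (X : computableMetric R).
Import metricType_numDomainType.

(* The standard function space representation: [p] is a name of [f] if [p]
   encodes a realizer of [f]. *)
Definition cont_name (p : nat -> nat) (f : continuousType X R^o) : Prop :=
  forall q (x : cms_space X), is_name q x ->
    exists2 r, kleene_app p q r & is_name (r := real_space R) r (f x).

Lemma kleene_app_fun p q r r' : kleene_app p q r -> kleene_app p q r' -> r = r'.
Proof.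
move=> pr pr'; apply/funext => n.
have [m [mr lm]] := pr n; have [m' [mr' lm']] := pr' n.
have [/lm'|/lm|mm'] := ltngtP m m'; rewrite ?mr ?mr' //.
by move: mr'; rewrite -mm' mr => -[].
Qed.

Lemma cont_name_fun p f g : cont_name p f -> cont_name p g -> f = g.
Proof.
move=> pf pg; apply/continuousEP => x.
have [q qx] := is_name_surj (x : cms_space X).
have [r pr rf] := pf _ _ qx; have [r' pr' rg] := pg _ _ qx.
by move: rg; rewrite -(kleene_app_fun pr pr'); exact: is_name_fun.
Qed.

Lemma cont_name_surj f : exists p, cont_name p f.
Proof.
pose P w n v := forall q (x : cms_space X), is_name q x ->
  mkseq q (size w) = w -> `|f x - nu_rat R v| <= 2 ^- n.+1.
pose ans w n := if pselect (exists v, P w n v) is left h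
                then (projT1 (cid h)).+1 else 0%N.
exists (fun c => if CodeSeq.decode c is n :: w then ans w n else 0%N).
move=> q x qx.
have ansP n : exists m, `[< exists v, P (mkseq q m) n v >].
  have := @cts_fun _ _ f x => /cvgrPdist_lt/(_ _ (exp2V_gt0 n.+2)).
  move=> /nbhs_mdistP[d /= d0 fd].
  have [m md] := exp2V_lt d0; exists m.+2; apply/asboolP.
  have [v fv] := dense_mdist (@nu_rat_dense R) (f x) (exp2V_gt0 n.+2).
  exists v => q' x' q'x'; rewrite size_mkseq => /(congr1 (nth 0%N ^~ m.+1)).
  rewrite !nth_mkseq// => qq'.
  have /fd /= : mdist x x' < d.
    rewrite (le_lt_trans _ md)//.
    rewrite (le_trans (metric_triangle _ (cms_seq X (q m.+1)) _))//.
    rewrite -exp2V_half; apply: lerD.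
      by rewrite metric_sym; exact: cauchy_name_dist.
    by rewrite -qq'; exact: cauchy_name_dist.
  move=> fxx'; rewrite -(exp2V_half n.+1).
  rewrite (le_trans (ler_distD (f x) _ _))// lerD//.
    by rewrite ltW.
  exact: ltW fv.
have h n : exists v, exists m, [/\ P (mkseq q m) n v, ans (mkseq q m) n = v.+1 &
    forall k, (k < m)%N -> ans (mkseq q k) n = 0%N].
  case: (ex_minnP (ansP n)) => m /asboolP mv mmin.
  have amv : exists v, P (mkseq q m) n v /\ ans (mkseq q m) n = v.+1.
    rewrite /ans; case: pselect => // hv; exists (projT1 (cid hv)); split => //.
    exact: (projT2 (cid hv)).
  have [v [Pv av]] := amv; exists v, m; split => // k km.
  rewrite /ans; case: pselect => // hv; have := mmin k (asboolT hv).
  by rewrite leqNgt km.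
have [r rh] := choice h; exists r.
  move=> n; have [m [_ av al]] := rh n; exists m.
  by rewrite CodeSeq.codeK; split => // k km; rewrite CodeSeq.codeK al.
apply: cauchy_name_approx => n; have [m [Pv _ _]] := rh n.
by apply: (Pv q); rewrite ?size_mkseq.
Qed.

Definition cont_space : repSpace := RepSpace cont_name_fun cont_name_surj.

Definition is_maximum (A : set R) (m : R) : Prop := A m /\ ubound A m.

Definition MAX : mfun cont_space (cms_space X) :=
  fun f : continuousType X R^o => [set x : X | is_maximum (range f) (f x)].

Definition ZERO : mfun cont_space (cms_space X) :=
  fun f : continuousType X R^o => f @^-1` [set 0].

End continuous_functions.

(* Main.v *)
From HB Require Import structures.
Require Import Defs.
From mathcomp Require Import all_boot all_order all_algebra.
From mathcomp Require Import all_classical all_reals all_analysis.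
From mathcomp Require Import lra.

(* MAX reduces to Z via [f |-> f - max f] and Z reduces to MAX via
   [f |-> - |f|]; in both cases the solution is returned unchanged.  The only
   delicate point is to compute [max f] from a name [p] of [f].  For a given
   precision [n] one searches for an enumerated finite cover of the space by
   rational balls such that each ball comes with a word [w] for which [p]
   answers the query [n] after reading exactly [w], and such that distance
   approximations certify that every point of the ball has a Cauchy name
   extending [w].  Then [f] varies by at most [2 ^- n] around the answer on each
   ball, so the maximum of the answers approximates [max f].  The search
   succeeds by compactness. *)

Set Implicit Arguments.
Unset Strict Implicit.
Unset Printing Implicit Defensive.

Import Order.TTheory GRing.Theory Num.Theory.
Import numFieldNormedType.Exports.

(** * Basic programs *)

Definition prog_pred : prog := PrimRec Zero (Proj 0).
Definition prog_not : prog := PrimRec (Comp Succ [:: Zero]) Zero.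
Definition prog_add : prog := PrimRec (Proj 0) (Comp Succ [:: Proj 1]).
(** Recursion runs on the first argument, so the number to be subtracted comes first. *)
Definition prog_sub : prog := PrimRec (Proj 0) (Comp prog_pred [:: Proj 1]).
Definition prog_mul : prog :=
  PrimRec Zero (Comp prog_add [:: Proj 1; Proj 2]).
Definition prog_exp2 : prog :=
  PrimRec (Comp Succ [:: Zero]) (Comp prog_add [:: Proj 1; Proj 1]).
Definition prog_odd : prog := PrimRec Zero (Comp prog_not [:: Proj 1]).
Definition prog_half : prog :=
  PrimRec Zero (Comp prog_add [:: Proj 1; Comp prog_odd [:: Proj 0]]).
Definition prog_halves : prog := PrimRec (Proj 0) (Comp prog_half [:: Proj 1]).
(** The code of [a :: s] is [2 ^ a * (2 b + 1)], where [b] is the code of [s]. *)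
Definition prog_cons : prog :=
  Comp prog_mul [:: Comp prog_exp2 [:: Proj 0];
                    Comp Succ [:: Comp prog_add [:: Proj 1; Proj 1]]].
(* The head of a nonzero code is its 2-adic valuation. *)
Definition prog_head : prog :=
  Mu (Comp prog_not
    [:: Comp prog_add
          [:: Comp prog_odd [:: Comp prog_halves [:: Proj 0; Proj 1]];
              Comp prog_not [:: Proj 1]]]).
(** Halving as often as the head says leaves [2 b + 1] with [b] the code of the tail; one more
    halving gives [b]. *)
Definition prog_behead : prog :=
  Comp prog_half [:: Comp prog_halves [:: prog_head; Proj 0]].

Section raw_programs.
Variable o : nat -> nat.

Lemma eval_comp1 f g xs y z :
  prog_eval o g xs y -> prog_eval o f [:: y] z ->
  prog_eval o (Comp f [:: g]) xs z.
Proof. by move=> gy fz; exists [:: y]. Qed.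

Lemma eval_comp2 f g h xs y1 y2 z :
  prog_eval o g xs y1 -> prog_eval o h xs y2 -> prog_eval o f [:: y1; y2] z ->
  prog_eval o (Comp f [:: g; h]) xs z.
Proof. by move=> gy hy fz; exists [:: y1; y2]. Qed.

Lemma eval_comp3 f g h k xs y1 y2 y3 z :
  prog_eval o g xs y1 -> prog_eval o h xs y2 -> prog_eval o k xs y3 ->
  prog_eval o f [:: y1; y2; y3] z ->
  prog_eval o (Comp f [:: g; h; k]) xs z.
Proof. by move=> gy hy ky fz; exists [:: y1; y2; y3]. Qed.

Lemma eval_primrec (r : nat -> nat) f g n xs :
  prog_eval o f xs (r 0) ->
  (forall m, prog_eval o g [:: m, r m & xs] (r m.+1)) ->
  prog_eval o (PrimRec f g) (n :: xs) (r n).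
Proof. by move=> f0 gS; elim: n => //= n ih; exists (r n); split. Qed.

Arguments eval_primrec r {f g n xs} _ _.

Lemma eval_pred n : prog_eval o prog_pred [:: n] n.-1.
Proof. exact: (eval_primrec predn). Qed.

Lemma eval_one xs : prog_eval o (Comp Succ [:: Zero]) xs 1.
Proof. exact: (eval_comp1 (y := 0)). Qed.

Lemma eval_not n : prog_eval o prog_not [:: n] (n == 0).
Proof. by apply: (eval_primrec (fun n => n == 0)) => //; exact: eval_one. Qed.

Lemma eval_add m n : prog_eval o prog_add [:: m; n] (m + n).
Proof.
apply: (eval_primrec (addn^~ n)) => // k.
exact: (eval_comp1 (y := k + n)).
Qed.

Lemma eval_sub m n : prog_eval o prog_sub [:: m; n] (n - m).
Proof.
apply: (eval_primrec (subn n)) => [|k]; first by rewrite subn0.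
by rewrite subnS; apply: (eval_comp1 (y := n - k)) => //; exact: eval_pred.
Qed.

Lemma eval_mul m n : prog_eval o prog_mul [:: m; n] (m * n).
Proof.
apply: (eval_primrec (muln^~ n)) => // k.
rewrite mulSn addnC; apply: (eval_comp2 (y1 := k * n) (y2 := n)) => //.
exact: eval_add.
Qed.

Lemma eval_exp2 n : prog_eval o prog_exp2 [:: n] (2 ^ n).
Proof.
apply: (eval_primrec (expn 2)) => [|k]; first exact: eval_one.
rewrite expnS mul2n -addnn.
by apply: (eval_comp2 (y1 := 2 ^ k) (y2 := 2 ^ k)) => //; exact: eval_add.
Qed.

Lemma eval_odd n : prog_eval o prog_odd [:: n] (odd n).
Proof.
apply: (eval_primrec (fun n => odd n)) => // k.
have -> : odd k.+1 = (odd k == 0 :> nat) by rewrite /=; case: odd.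
by apply: (eval_comp1 (y := odd k)) => //; exact: eval_not.
Qed.

Lemma eval_half n : prog_eval o prog_half [:: n] n./2.
Proof.
apply: (eval_primrec (half)) => // k.
rewrite -[k.+1./2]/(uphalf k) uphalf_half addnC.
apply: (eval_comp2 (y1 := k./2) (y2 := odd k)) => //; last exact: eval_add.
by apply: (eval_comp1 (y := k)) => //; exact: eval_odd.
Qed.

Lemma eval_halves k n : prog_eval o prog_halves [:: k; n] (iter k half n).
Proof.
apply: (eval_primrec (fun k => iter k half n)) => // m.
by apply: (eval_comp1 (y := iter m half n)) => //; exact: eval_half.
Qed.

Lemma eval_cons a b : prog_eval o prog_cons [:: a; b] (2 ^ a * b.*2.+1).
Proof.
apply: (eval_comp2 (y1 := 2 ^ a) (y2 := b.*2.+1)); last exact: eval_mul.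
  by apply: (eval_comp1 (y := a)) => //; exact: eval_exp2.
apply: (eval_comp1 (y := b.*2)) => //.
rewrite -addnn; apply: (eval_comp2 (y1 := b) (y2 := b)) => //.
exact: eval_add.
Qed.

Lemma iter_half k a n : k <= a -> iter k half (2 ^ a * n) = 2 ^ (a - k) * n.
Proof.
elim: k => [|k ih] ka; first by rewrite subn0.
rewrite iterS ih ?(ltnW ka)//.
have -> : a - k = (a - k.+1).+1 by rewrite subnSK.
by rewrite expnS -mulnA mul2n doubleK.
Qed.

Lemma eval_head s : prog_eval o prog_head [:: CodeSeq.code s] (head 0 s).
Proof.
set n := CodeSeq.code s.
(* The summand [n == 0] stops the search at once on the empty list, whose code 0 never becomes odd
   by halving. *)
have bodyP m : prog_eval o (Comp prog_not
      [:: Comp prog_add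
            [:: Comp prog_odd [:: Comp prog_halves [:: Proj 0; Proj 1]];
                Comp prog_not [:: Proj 1]]])
    [:: m; n] (odd (iter m half n) + (n == 0) == 0).
  apply: eval_comp1 (eval_not _).
  apply: eval_comp2 (eval_add _ _).
    apply: eval_comp1 (eval_odd _).
    by apply: eval_comp2 (eval_halves _ _).
  by apply: eval_comp1 (eval_not _).
split.
  have := bodyP (head 0 s); congr (prog_eval _ _ _ _).
  rewrite /n; case: (s) => [//|a s'].
  by rewrite /= iter_half// subnn mul1n /= odd_double.
move=> m mn; exists 0; have := bodyP m; congr (prog_eval _ _ _ _).
move: mn; rewrite /n; case: (s) => [//|a s'] /= ma.
rewrite iter_half ?(ltnW ma)// muln_eq0 expn_eq0/= addn0 oddM/= odd_double/=.
by rewrite oddX subn_eq0 leqNgt ma.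
Qed.

Lemma eval_behead s :
  prog_eval o prog_behead [:: CodeSeq.code s] (CodeSeq.code (behead s)).
Proof.
have -> : CodeSeq.code (behead s) = (iter (head 0 s) half (CodeSeq.code s))./2.
  case: s => //= a s.
  by rewrite iter_half// subnn mul1n /= uphalf_double.
apply: eval_comp1 (eval_half _).
by apply: eval_comp2 (eval_halves _ _) => //; exact: eval_head.
Qed.

End raw_programs.

(** * Erasing the oracle from a program *)

Fixpoint forget_oracle (e : prog) : prog :=
  match e with
  | Oracle => Zero
  | Comp f gs => Comp (forget_oracle f) (map forget_oracle gs)
  | PrimRec f g => PrimRec (forget_oracle f) (forget_oracle g)
  | Mu f => Mu (forget_oracle f)
  | _ => e
  end.

(** Distances and finite covers are computed with the zero oracle; this makes their programs usable
    when the oracle is a name of a function. *)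
Lemma eval_forget_oracle o e xs y :
  prog_eval (fun=> 0) e xs y -> prog_eval o (forget_oracle e) xs y.
Proof.
(* Programs are nested in the list of a [Comp], hence the direct recursion and the inner induction
   on that list. *)
move: e xs y; fix IH 1 => -[||i||f gs|f g|f] xs y //=.
- move=> [ys [gys fy]]; exists ys; split; last exact: IH.
  elim: gs ys gys {fy} => [|g gs ihgs] [|z zs]//= [gz gszs].
  by split; [exact: IH|exact: ihgs].
- elim: (nth 0 xs 0) y => [|n ih] y; first exact: IH.
  by move=> [z [rz gz]]; exists z; split; [exact: ih|exact: IH].
- move=> [fy fm]; split; first exact: IH.
  by move=> m /fm[z fz]; exists z; exact: IH.
Qed.

(** * Uniform computability on encoded types *)

Class encoding (T : Type) := enc : T -> nat.
#[export] Instance enc_nat : encoding nat := id.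
#[export] Instance enc_bool : encoding bool := nat_of_bool.
#[export] Instance enc_seq : encoding (seq nat) := CodeSeq.code.
(** A pair is coded as its first component put in front of the list coded by the second, so the list
    programs serve as pairing and projections. *)
#[export] Instance enc_prod {T U} {eT : encoding T} {eU : encoding U} :
  encoding (T * U) := fun x => 2 ^ enc x.1 * (enc x.2).*2.+1.

Lemma enc_pairE {T U} {eT : encoding T} {eU : encoding U} (x : T) (y : U) :
  enc (x, y) = CodeSeq.code (enc x :: CodeSeq.decode (enc y)).
Proof. by rewrite /= CodeSeq.decodeK. Qed.

(* [cpt P F]: a single program computes [F o x] from a code of [x], for every
   oracle [o] in [P]. *)
Variant cpt (P : set (nat -> nat)) {T U} {eT : encoding T} {eU : encoding U}
    (F : (nat -> nat) -> T -> U) : Prop :=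
  Cpt e of forall o, P o -> forall x, prog_eval o e [:: enc x] (enc (F o x)).

Section closure_properties.
Variable P : set (nat -> nat).
Context {T : Type} {eT : encoding T}.
Implicit Type o : nat -> nat.

Lemma cpt_ext {U} {eU : encoding U} (F G : (nat -> nat) -> T -> U) :
  (forall o x, F o x = G o x) -> cpt P F -> cpt P G.
Proof. by move=> FG [e eF]; exists e => o Po x; rewrite -FG; exact: eF. Qed.

Lemma cpt_id : cpt P (fun o (x : T) => x).
Proof. by exists (Proj 0). Qed.

Lemma cpt_cst {U} {eU : encoding U} (c : U) : cpt P (fun o (x : T) => c).
Proof.
suff cstc n : exists e, forall o xs, prog_eval o e xs n.
  by have [e ec] := cstc (enc c); exists e => o _ x; exact: ec.
elim: n => [|n [e en]]; first by exists Zero.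
exists (Comp Succ [:: e]) => o xs.
by apply: eval_comp1 (en o xs) _.
Qed.

Lemma cpt_raw1 {U V} {eU : encoding U} {eV : encoding V} e (f : U -> V)
    (F : (nat -> nat) -> T -> U) :
  (forall o x, prog_eval o e [:: enc x] (enc (f x))) ->
  cpt P F -> cpt P (fun o x => f (F o x)).
Proof.
move=> ef [g gF]; exists (Comp e [:: g]) => o Po x.
exact: eval_comp1 (gF _ Po x) (ef _ _).
Qed.

Lemma cpt_raw2 {U V W} {eU : encoding U} {eV : encoding V} {eW : encoding W} e
    (f : U -> V -> W) (F : (nat -> nat) -> T -> U)
    (G : (nat -> nat) -> T -> V) :
  (forall o x y, prog_eval o e [:: enc x; enc y] (enc (f x y))) ->
  cpt P F -> cpt P G -> cpt P (fun o x => f (F o x) (G o x)).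
Proof.
move=> ef [g gF] [h hG]; exists (Comp e [:: g; h]) => o Po x.
exact: eval_comp2 (gF _ Po x) (hG _ Po x) (ef _ _ _).
Qed.

Lemma cpt_comp {U V} {eU : encoding U} {eV : encoding V}
    (f : (nat -> nat) -> U -> V) (F : (nat -> nat) -> T -> U) :
  cpt P f -> cpt P F -> cpt P (fun o x => f o (F o x)).
Proof.
move=> [e ef] [g gF]; exists (Comp e [:: g]) => o Po x.
exact: eval_comp1 (gF _ Po x) (ef _ Po _).
Qed.

Lemma cpt_pair {U V} {eU : encoding U} {eV : encoding V}
    (F : (nat -> nat) -> T -> U) (G : (nat -> nat) -> T -> V) :
  cpt P F -> cpt P G -> cpt P (fun o x => (F o x, G o x)).
Proof. by apply: (cpt_raw2 (f := pair)) => o x y; exact: eval_cons. Qed.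

Lemma cpt_fst {U V} {eU : encoding U} {eV : encoding V}
    (F : (nat -> nat) -> T -> U * V) : cpt P F -> cpt P (fun o x => (F o x).1).
Proof.
apply: (cpt_raw1 (e := prog_head)) => o [u v].
rewrite (enc_pairE u v); exact: eval_head.
Qed.

Lemma cpt_snd {U V} {eU : encoding U} {eV : encoding V}
    (F : (nat -> nat) -> T -> U * V) : cpt P F -> cpt P (fun o x => (F o x).2).
Proof.
apply: (cpt_raw1 (e := prog_behead)) => o [u v].
have -> : enc (u, v).2 =
    CodeSeq.code (behead (enc u :: CodeSeq.decode (enc v))).
  by rewrite /= CodeSeq.decodeK.
rewrite (enc_pairE u v); exact: eval_behead.
Qed.

Lemma cpt_oracle F : cpt P F -> cpt P (fun o (x : T) => o (F o x)).
Proof.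
move=> [e eF]; exists (Comp Oracle [:: e]) => o Po x.
exact: eval_comp1 (eF _ Po x) _.
Qed.

Lemma cpt_succ F : cpt P F -> cpt P (fun o (x : T) => (F o x).+1).
Proof. exact: (cpt_raw1 (e := Succ)). Qed.

Lemma cpt_predn F : cpt P F -> cpt P (fun o (x : T) => (F o x).-1).
Proof. by apply: (cpt_raw1 (f := predn)) => o x; exact: eval_pred. Qed.

Lemma cpt_addn F G :
  cpt P F -> cpt P G -> cpt P (fun o (x : T) => F o x + G o x).
Proof. by apply: (cpt_raw2 (f := addn)) => o x y; exact: eval_add. Qed.

Lemma cpt_muln F G :
  cpt P F -> cpt P G -> cpt P (fun o (x : T) => F o x * G o x).
Proof. by apply: (cpt_raw2 (f := muln)) => o x y; exact: eval_mul. Qed.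

Lemma cpt_subn F G :
  cpt P F -> cpt P G -> cpt P (fun o (x : T) => F o x - G o x).
Proof.
move=> Fc Gc.
by apply: (cpt_raw2 (f := fun x y => y - x)) Gc Fc => o x y; exact: eval_sub.
Qed.

Lemma cpt_exp2 F : cpt P F -> cpt P (fun o (x : T) => 2 ^ F o x).
Proof. by apply: (cpt_raw1 (f := expn 2)) => o x; exact: eval_exp2. Qed.

Lemma cpt_eq0 F : cpt P F -> cpt P (fun o (x : T) => F o x == 0).
Proof. by apply: (cpt_raw1 (f := fun n => n == 0)) => o x; exact: eval_not. Qed.

Lemma cpt_nat_of_bool B :
  cpt P B -> cpt P (fun o (x : T) => nat_of_bool (B o x)).
Proof. exact: (cpt_raw1 (e := Proj 0)). Qed.

Lemma cpt_leq F G :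
  cpt P F -> cpt P G -> cpt P (fun o (x : T) => F o x <= G o x).
Proof. by move=> Fc Gc; apply: cpt_eq0; exact: cpt_subn. Qed.

Lemma cpt_code F : cpt P F -> cpt P (fun o (x : T) => CodeSeq.code (F o x)).
Proof. exact: (cpt_raw1 (e := Proj 0) (f := CodeSeq.code)). Qed.

Lemma cpt_decode F : cpt P F -> cpt P (fun o (x : T) => CodeSeq.decode (F o x)).
Proof.
apply: (cpt_raw1 (e := Proj 0) (f := CodeSeq.decode)) => o x /=.
exact: CodeSeq.decodeK.
Qed.

Lemma cpt_cons F G :
  cpt P F -> cpt P G -> cpt P (fun o (x : T) => F o x :: G o x : seq nat).
Proof. by apply: (cpt_raw2 (f := cons)) => o x y; exact: eval_cons. Qed.

Lemma cpt_head (F : (nat -> nat) -> T -> seq nat) :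
  cpt P F -> cpt P (fun o x => head 0 (F o x)).
Proof.
apply: (cpt_raw1 (e := prog_head) (f := head 0)) => o x.
exact: eval_head.
Qed.

Lemma cpt_behead (F : (nat -> nat) -> T -> seq nat) :
  cpt P F -> cpt P (fun o x => behead (F o x)).
Proof.
apply: (cpt_raw1 (e := prog_behead) (f := behead)) => o x.
exact: eval_behead.
Qed.

Lemma cpt_nat_rect {U} {eU : encoding U} N F
    (G : (nat -> nat) -> T -> nat -> U -> U) :
  cpt P N -> cpt P F -> cpt P (fun o x => G o x.1.1 x.1.2 x.2) ->
  cpt P (fun o (x : T) => nat_rect (fun=> U) (F o x) (G o x) (N o x)).
Proof.
move=> [eN hN] [eF hF] [eG hG].
(* [PrimRec] passes the counter, the previous value and the parameter in this order; they are
   repacked as the code of [((x, m), z)]. *)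
pose st := Comp eG [:: Comp prog_cons
  [:: Comp prog_cons [:: Proj 2; Proj 0]; Proj 1]].
exists (Comp (PrimRec eF st) [:: eN; Proj 0]) => o Po x.
apply: (eval_comp2 (hN _ Po x)) => //.
apply (@eval_primrec o (fun n => enc (nat_rect (fun=> U) (F o x) (G o x) n))).
  exact: hF.
move=> m; set z := nat_rect _ _ _ m.
apply: eval_comp1 (hG _ Po (x, m, z)).
apply: eval_comp2 (eval_cons _ _ _) => //.
exact: eval_comp2 (eval_cons _ _ _).
Qed.

Lemma cpt_mu (B : (nat -> nat) -> T -> nat -> bool) :
  cpt P (fun o x => B o x.1 x.2) ->
  (forall o, P o -> forall x, exists y, B o x y) ->
  exists2 F, cpt P F & forall o, P o -> forall x, B o x (F o x).
Proof.
move=> [e eB] Bex.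
(* The least witness is the one that [Mu] finds. Outside [P] there may be none, and 0 is a default
   value. *)
have minB o x : exists y, P o -> B o x y /\ forall m, m < y -> B o x m = false.
  have [Po|nPo] := pselect (P o); last by exists 0.
  case: (ex_minnP (Bex o Po x)) => y By ymin; exists y => _; split => // m my.
  by apply: contraTF my => /ymin; rewrite leqNgt.
have [F hF] : exists F, forall o x, P o ->
    B o x (F o x) /\ forall m, m < F o x -> B o x m = false.
  have [F hF] := choice (fun ox => minB ox.1 ox.2).
  by exists (fun o x => F (o, x)) => o x; exact: (hF (o, x)).
exists F; last by move=> o Po x; have [] := hF o x Po.
exists (Mu (Comp prog_not [:: Comp e [:: Comp prog_cons [:: Proj 1; Proj 0]]])).
move=> o Po x; have [Fx Fmin] := hF o x Po.
have ev m : prog_eval o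
    (Comp prog_not [:: Comp e [:: Comp prog_cons [:: Proj 1; Proj 0]]])
    [:: m; enc x] (nat_of_bool (B o x m) == 0).
  apply: eval_comp1 (eval_not _ _); apply: eval_comp1 (eB _ Po (x, m)).
  exact: eval_comp2 (eval_cons _ _ _).
split; first by have := ev (F o x); rewrite Fx.
by move=> m /Fmin Bm; exists 0; have := ev m; rewrite Bm.
Qed.

End closure_properties.

Section derived_closure_properties.
Variable P : set (nat -> nat).
Context {T : Type} {eT : encoding T}.
Implicit Type o : nat -> nat.

(** A conditional is a recursion of length 0 or 1, the boolean being the number of steps. *)
Lemma cpt_if {U} {eU : encoding U} B (F G : (nat -> nat) -> T -> U) :
  cpt P B -> cpt P F -> cpt P G ->
  cpt P (fun o x => if B o x then F o x else G o x).
Proof.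
move=> Bc Fc Gc.
apply: (@cpt_ext _ _ _ _ _
  (fun o x => nat_rect (fun=> U) (G o x) (fun _ _ => F o x) (B o x))).
  by move=> o x; case: (B o x).
apply: (cpt_nat_rect (N := fun o x => nat_of_bool (B o x))
  (G := fun o x _ _ => F o x)) => //=; first exact: cpt_nat_of_bool.
apply: (cpt_comp (F := fun o (x : T * nat * U) => x.1.1) Fc).
by do 2!apply: cpt_fst; exact: cpt_id.
Qed.

Lemma cpt_andb B C :
  cpt P B -> cpt P C -> cpt P (fun o (x : T) => B o x && C o x).
Proof. by move=> Bc Cc; apply: cpt_if => //; exact: cpt_cst. Qed.

Lemma cpt_negb B : cpt P B -> cpt P (fun o (x : T) => ~~ B o x).
Proof. by move=> Bc; apply: cpt_if => //; exact: cpt_cst. Qed.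

Lemma cpt_eqn F G :
  cpt P F -> cpt P G -> cpt P (fun o (x : T) => F o x == G o x :> nat).
Proof.
move=> Fc Gc; apply: (@cpt_ext _ _ _ _ _
    (fun o x => (F o x <= G o x) && (G o x <= F o x))).
  by move=> o x; rewrite eqn_leq.
by apply: cpt_andb; exact: cpt_leq.
Qed.

End derived_closure_properties.

(** * Recursion over finite lists *)

Section seq_closure_properties.
Variable P : set (nat -> nat).
Context {T : Type} {eT : encoding T}.
Implicit Type o : nat -> nat.

(** The fold becomes a primitive recursion on pairs of remaining list and accumulator. Its length is
    the code of the list, which is at least the size; surplus steps meet the empty list, the only
    one with code 0, and change nothing. *)
Lemma cpt_foldl {U} {eU : encoding U}
    (G : (nat -> nat) -> T -> U -> nat -> U) F S :
  cpt P (fun o x => G o x.1.1 x.1.2 x.2) -> cpt P F -> cpt P S ->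
  cpt P (fun o (x : T) => foldl (G o x) (F o x) (S o x)).
Proof.
move=> Gc Fc Sc.
pose step o x (_ : nat) (z : seq nat * U) := (behead z.1,
  if CodeSeq.code z.1 == 0 then z.2 else G o x z.2 (head 0 z.1)).
apply: (@cpt_ext _ _ _ _ _ (fun o x => (nat_rect (fun=> seq nat * U)%type
    (S o x, F o x) (step o x) (CodeSeq.code (S o x))).2)).
  move=> o x; set n := CodeSeq.code _.
  have : size (S o x) <= n.
    rewrite /n; elim: (S o x) => //= a s ih; rewrite (leq_ltn_trans ih)//.
    rewrite (@leq_trans (2 ^ a * (CodeSeq.code s).+1))//.
      by rewrite leq_pmull ?expn_gt0.
    by rewrite leq_mul// ltnS -addnn leq_addr.
  move: n => n.
  have stepE s u k : (nat_rect (fun=> seq nat * U)%type (s, u) (step o x) k) =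
      (drop k s, foldl (G o x) u (take k s)).
    elim: k => [|k /= ->]; first by rewrite drop0 take0.
    rewrite /step/= -drop1 drop_drop add1n; congr (_, _).
    have [ks|sk] := ltnP k (size s); last first.
      by rewrite drop_oversize// !take_oversize// ltnW.
    rewrite (drop_nth 0 ks) /= muln_eq0 expn_eq0/= (take_nth 0 ks).
    by rewrite -cats1 foldl_cat.
  by move=> sn; rewrite stepE take_oversize.
apply: cpt_snd; apply: cpt_nat_rect; [exact: cpt_code|exact: cpt_pair|].
have c1 : cpt P (fun o (x : T * nat * (seq nat * U)) => x.2.1).
  by apply: cpt_fst; apply: cpt_snd; exact: cpt_id.
have c2 : cpt P (fun o (x : T * nat * (seq nat * U)) => x.2.2).
  by apply: cpt_snd; apply: cpt_snd; exact: cpt_id.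
rewrite /step; apply: cpt_pair; first exact: cpt_behead.
apply: cpt_if => //; first by apply: cpt_eq0; exact: cpt_code.
apply: (cpt_comp (f := fun o x => G o x.1.1 x.1.2 x.2)
  (F := fun o (x : T * nat * (seq nat * U)) =>
          (x.1.1, x.2.2, head 0 x.2.1))) => //.
apply: cpt_pair; last exact: cpt_head.
by apply: cpt_pair => //; do 2!apply: cpt_fst; exact: cpt_id.
Qed.

End seq_closure_properties.

(** Picks the closure lemma from the outermost operation of the function; constants are tried
    last. *)
Ltac cpt_step := cbv beta; lazymatch goal with
  | H : @cpt _ _ _ _ _ ?F |- @cpt _ _ _ _ _ ?F => exact: H
  | H : @cpt _ _ _ _ _ ?F |- @cpt _ _ _ _ _ (fun o x => ?F o x) => exact: H
  | |- @cpt _ _ _ _ _ (fun o x => x) => exact: cpt_id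
  | |- @cpt _ _ _ _ _ (fun o x => fst (@?F o x)) => apply: cpt_fst
  | |- @cpt _ _ _ _ _ (fun o x => snd (@?F o x)) => apply: cpt_snd
  | |- @cpt _ _ _ _ _ (fun o x => pair (@?F o x) (@?G o x)) => apply: cpt_pair
  | |- @cpt _ _ _ _ _ (fun o x => o (@?F o x)) => apply: cpt_oracle
  | |- @cpt _ _ _ _ _ (fun o x => succn (@?F o x)) => apply: cpt_succ
  | |- @cpt _ _ _ _ _ (fun o x => predn (@?F o x)) => apply: cpt_predn
  | |- @cpt _ _ _ _ _ (fun o x => addn (@?F o x) (@?G o x)) => apply: cpt_addn
  | |- @cpt _ _ _ _ _ (fun o x => muln (@?F o x) (@?G o x)) => apply: cpt_muln
  | |- @cpt _ _ _ _ _ (fun o x => subn (@?F o x) (@?G o x)) => apply: cpt_subn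
  | |- @cpt _ _ _ _ _ (fun o x => expn 2 (@?F o x)) => apply: cpt_exp2
  | |- @cpt _ _ _ _ _ (fun o x => leq (@?F o x) (@?G o x)) => apply: cpt_leq
  | |- @cpt _ _ _ _ _ (fun o x => @eq_op _ (@?F o x) (@?G o x)) =>
      apply: cpt_eqn
  | |- @cpt _ _ _ _ _ (fun o x => negb (@?F o x)) => apply: cpt_negb
  | |- @cpt _ _ _ _ _ (fun o x => andb (@?F o x) (@?G o x)) => apply: cpt_andb
  | |- @cpt _ _ _ _ _ (fun o x => CodeSeq.code (@?F o x)) => apply: cpt_code
  | |- @cpt _ _ _ _ _ (fun o x => CodeSeq.decode (@?F o x)) => apply: cpt_decode
  | |- @cpt _ _ _ _ _ (fun o x => cons (@?F o x) (@?G o x)) => apply: cpt_cons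
  | |- @cpt _ _ _ _ _ (fun o x => head 0 (@?F o x)) => apply: cpt_head
  | |- @cpt _ _ _ _ _ (fun o x => behead (@?F o x)) => apply: cpt_behead
  | |- @cpt _ _ _ _ _ (fun o x => foldl (@?G o x) (@?F o x) (@?S o x)) =>
      apply: cpt_foldl
  | |- @cpt _ _ _ _ _ (fun o x => nat_rect _ (@?F o x) (@?G o x) (@?N o x)) =>
      apply: cpt_nat_rect
  | |- @cpt _ _ _ _ _ (fun o x => _) => exact: cpt_cst
  end.
Ltac cpt_tac := repeat cpt_step.

Section seq_operations.
Variable P : set (nat -> nat).
Context {T : Type} {eT : encoding T}.
Implicit Type o : nat -> nat.

Lemma cpt_rev S : cpt P S -> cpt P (fun o (x : T) => rev (S o x) : seq nat).
Proof.
move=> Sc.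
apply: (@cpt_ext _ _ _ _ _ (fun o x => foldl (fun s a => a :: s) [::] (S o x))).
  move=> o x; rewrite /rev; move: (S o x) [::]; elim=> [|a s ih] t //=.
by cpt_tac.
Qed.

Lemma cpt_foldr {U} {eU : encoding U}
    (G : (nat -> nat) -> T -> nat -> U -> U) F S :
  cpt P (fun o x => G o x.1.1 x.1.2 x.2) -> cpt P F -> cpt P S ->
  cpt P (fun o (x : T) => foldr (G o x) (F o x) (S o x)).
Proof.
move=> Gc Fc Sc.
apply: (@cpt_ext _ _ _ _ _
    (fun o x => foldl (fun z a => G o x a z) (F o x) (rev (S o x)))).
  by move=> o x; rewrite foldl_rev.
apply: cpt_foldl => //; last exact: cpt_rev.
apply: (cpt_comp (f := fun o (x : T * nat * U) => G o x.1.1 x.1.2 x.2)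
  (F := fun o (x : T * U * nat) => (x.1.1, x.2, x.1.2))) => //.
by cpt_tac.
Qed.

Lemma cpt_size (S : (nat -> nat) -> T -> seq nat) :
  cpt P S -> cpt P (fun o (x : T) => size (S o x)).
Proof.
move=> Sc; apply: (@cpt_ext _ _ _ _ _
    (fun o x => foldr (fun _ n => n.+1) 0 (S o x))).
  by [].
by apply: cpt_foldr; cpt_tac.
Qed.

Lemma cpt_map G S : cpt P (fun o x => G o x.1 x.2) -> cpt P S ->
  cpt P (fun o (x : T) => map (G o x) (S o x) : seq nat).
Proof.
move=> Gc Sc.
apply: (@cpt_ext _ _ _ _ _
    (fun o x => foldr (fun a s => G o x a :: s) [::] (S o x))).
  by [].
apply: cpt_foldr; cpt_tac.
apply: (cpt_comp (f := fun o (x : T * nat) => G o x.1 x.2)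
  (F := fun o (x : T * nat * seq nat) => x.1)) => //.
by cpt_tac.
Qed.

Lemma cpt_all B S : cpt P (fun o x => B o x.1 x.2) -> cpt P S ->
  cpt P (fun o (x : T) => all (B o x) (S o x : seq nat)).
Proof.
move=> Bc Sc.
apply: (@cpt_ext _ _ _ _ _
    (fun o x => foldr (fun a b => B o x a && b) true (S o x))).
  by [].
apply: cpt_foldr; cpt_tac.
apply: (cpt_comp (f := fun o (x : T * nat) => B o x.1 x.2)
  (F := fun o (x : T * nat * bool) => x.1)) => //.
by cpt_tac.
Qed.

Lemma cpt_nth S N : cpt P S -> cpt P N ->
  cpt P (fun o (x : T) => nth 0 (S o x) (N o x)).
Proof.
move=> Sc Nc; apply: (@cpt_ext _ _ _ _ _ (fun o x =>
    head 0 (nat_rect (fun=> seq nat) (S o x) (fun _ s => behead s) (N o x)))).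
  move=> o x; rewrite -nth0 -[N o x in RHS]addn0 -nth_drop; congr (nth _ _ _).
  elim: (N o x) => [|n ih] /=; first by rewrite drop0.
  by rewrite ih -drop1 drop_drop.
by cpt_tac.
Qed.

Lemma cpt_mkseq G N : cpt P (fun o x => G o x.1 x.2) -> cpt P N ->
  cpt P (fun o (x : T) => mkseq (G o x) (N o x) : seq nat).
Proof.
move=> Gc Nc; apply: (@cpt_ext _ _ _ _ _ (fun o x =>
    rev (nat_rect (fun=> seq nat) [::] (fun n s => G o x n :: s) (N o x)))).
  move=> o x; apply: (can_inj revK); rewrite revK.
  elim: (N o x) => //= n ->.
  by rewrite /mkseq -addn1 iotaD map_cat /= rev_cat.
apply: cpt_rev; cpt_tac.
apply: (cpt_comp (f := fun o (x : T * nat) => G o x.1 x.2)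
  (F := fun o (x : T * nat * seq nat) => x.1)) => //.
by cpt_tac.
Qed.

End seq_operations.

Lemma computable_fun_eval g : computable_fun g ->
  exists e, forall o n, prog_eval o e [:: n] (g n).
Proof.
move=> [e eg]; exists (forget_oracle e) => o n; exact: eval_forget_oracle.
Qed.

(** * Rational arithmetic on codes *)

Definition qpos (x : nat) : nat := nth 0 (CodeSeq.decode x) 0.
Definition qneg (x : nat) : nat := nth 0 (CodeSeq.decode x) 1.
Definition qden (x : nat) : nat := (nth 0 (CodeSeq.decode x) 2).+1.
Definition qmk (u v d : nat) : nat := CodeSeq.code [:: u; v; d.-1].
Definition qadd (x y : nat) : nat :=
  qmk (qpos x * qden y + qpos y * qden x) (qneg x * qden y + qneg y * qden x)
      (qden x * qden y).
Definition qopp (x : nat) : nat := qmk (qneg x) (qpos x) (qden x).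
(** Cross-multiplied, with negative parts moved across because subtraction of naturals truncates. *)
Definition qle (x y : nat) : bool :=
  qpos x * qden y + qneg y * qden x <= qpos y * qden x + qneg x * qden y.
Definition qmax (x y : nat) : nat := if qle x y then y else x.
(* [0] codes the empty list, hence the rational number 0. *)
Definition qoppabs (x : nat) : nat := if qle x 0 then x else qopp x.
Definition qexp2V (n : nat) : nat := qmk 1 0 (2 ^ n).

Section rational_codes.
Variable R : realType.
Local Open Scope ring_scope.
Notation nu := (nu_rat R).

Lemma nu_ratE x : nu x = ((qpos x)%:R - (qneg x)%:R) / (qden x)%:R.
Proof. by []. Qed.

Lemma qden_neq0 x : (qden x)%:R != 0 :> R.
Proof. by rewrite pnatr_eq0. Qed.

Lemma nu_qmk u v d : (0 < d)%N -> nu (qmk u v d) = (u%:R - v%:R) / d%:R.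
Proof. by move=> d0; rewrite /nu_rat CodeSeq.codeK /= prednK. Qed.

Lemma nu_qadd x y : nu (qadd x y) = nu x + nu y.
Proof.
rewrite nu_qmk ?muln_gt0// !nu_ratE addf_div ?qden_neq0// natrM; congr (_ / _).
by rewrite !natrD !natrM !mulrBl opprD addrACA.
Qed.

Lemma nu_qopp x : nu (qopp x) = - nu x.
Proof. by rewrite nu_qmk// nu_ratE -mulNr opprB. Qed.

Lemma qleE x y : qle x y = (nu x <= nu y).
Proof.
rewrite !nu_ratE ler_pdivrMr ?ltr0n// mulrAC ler_pdivlMr ?ltr0n//.
rewrite !mulrBl lerBlDr addrAC lerBrDr -!natrM -!natrD ler_nat.
by rewrite /qle.
Qed.

Lemma nu_qmax x y : nu (qmax x y) = Num.max (nu x) (nu y).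
Proof. by rewrite /qmax qleE; case: leP. Qed.

(** The maximum as an attained upper bound, the form used for the two estimates in
    [good_cover_sound]. *)
Lemma nu_foldr_qmax (h : nat -> nat) z s :
  (forall x, x \in s -> nu (h x) <= nu (foldr (fun x => qmax (h x)) z s)) /\
  (nu (foldr (fun x => qmax (h x)) z s) = nu z \/
   exists2 x, x \in s & nu (foldr (fun x => qmax (h x)) z s) = nu (h x)).
Proof.
elim: s => [|x s [ihle iheq]] /=; first by split; [|left].
rewrite nu_qmax; split.
  move=> y; rewrite inE => /predU1P[->|/ihle hy]; first by rewrite le_max lexx.
  by rewrite le_max hy orbT.
case: leP => _; last by right; exists x; rewrite ?mem_head.
case: iheq => [->|[y ys ->]]; [by left|right].
by exists y; rewrite // inE ys orbT.
Qed.

Lemma nu_qoppabs x : nu (qoppabs x) = - `|nu x|.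
Proof.
have nu0 : nu 0 = 0 by rewrite /nu_rat /= subr0 mul0r.
rewrite /qoppabs qleE nu0; case: leP => x0; first by rewrite ler0_norm// opprK.
by rewrite nu_qopp gtr0_norm.
Qed.

Lemma nu_qexp2V n : nu (qexp2V n) = 2 ^- n.
Proof. by rewrite nu_qmk ?expn_gt0// subr0 mul1r natrX. Qed.

End rational_codes.

Section computable_rational_codes.
Variable P : set (nat -> nat).
Context {T : Type} {eT : encoding T}.
Implicit Types F G : (nat -> nat) -> T -> nat.

Lemma cpt_qpos F : cpt P F -> cpt P (fun o x => qpos (F o x)).
Proof. by move=> Fc; apply: cpt_nth; cpt_tac. Qed.

Lemma cpt_qneg F : cpt P F -> cpt P (fun o x => qneg (F o x)).
Proof. by move=> Fc; apply: cpt_nth; cpt_tac. Qed.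

Lemma cpt_qden F : cpt P F -> cpt P (fun o x => qden (F o x)).
Proof. by move=> Fc; apply: cpt_succ; apply: cpt_nth; cpt_tac. Qed.

Lemma cpt_qmk F G H :
  cpt P F -> cpt P G -> cpt P H ->
  cpt P (fun o (x : T) => qmk (F o x) (G o x) (H o x)).
Proof. by move=> *; rewrite /qmk; cpt_tac. Qed.

Lemma cpt_qle F G :
  cpt P F -> cpt P G -> cpt P (fun o x => qle (F o x) (G o x)).
Proof.
move=> Fc Gc; have := (cpt_qpos Fc, cpt_qneg Fc, cpt_qden Fc).
have := (cpt_qpos Gc, cpt_qneg Gc, cpt_qden Gc) => -[[? ?] ?] [[? ?] ?].
by rewrite /qle; cpt_tac.
Qed.

Lemma cpt_qadd F G :
  cpt P F -> cpt P G -> cpt P (fun o x => qadd (F o x) (G o x)).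
Proof.
move=> Fc Gc; have := (cpt_qpos Fc, cpt_qneg Fc, cpt_qden Fc).
have := (cpt_qpos Gc, cpt_qneg Gc, cpt_qden Gc) => -[[? ?] ?] [[? ?] ?].
by rewrite /qadd; apply: cpt_qmk; cpt_tac.
Qed.

Lemma cpt_qopp F : cpt P F -> cpt P (fun o x => qopp (F o x)).
Proof.
by move=> Fc; apply: cpt_qmk; [exact: cpt_qneg|exact: cpt_qpos|exact: cpt_qden].
Qed.

Lemma cpt_qmax F G :
  cpt P F -> cpt P G -> cpt P (fun o x => qmax (F o x) (G o x)).
Proof. by move=> Fc Gc; apply: cpt_if => //; exact: cpt_qle. Qed.

Lemma cpt_qoppabs F : cpt P F -> cpt P (fun o x => qoppabs (F o x)).
Proof.
move=> Fc; apply: cpt_if; [|by []|exact: cpt_qopp].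
by apply: cpt_qle => //; exact: cpt_cst.
Qed.

Lemma cpt_qexp2V F : cpt P F -> cpt P (fun o x => qexp2V (F o x)).
Proof. by move=> Fc; apply: cpt_qmk; cpt_tac. Qed.

End computable_rational_codes.

(** * Certified finite covers and the programs that check them *)

Definition center_of (b : nat) : nat := nth 0 (CodeSeq.decode b) 0.
Definition radius_of (b : nat) : nat :=
  qmk (nth 0 (CodeSeq.decode b) 1).+1 0 (nth 0 (CodeSeq.decode b) 2).+1.

(* An item [b :: k :: w] consists of a coded ball [b], a precision [k] at which
   distances are evaluated, and a word [w]. *)
Definition item_ball (it : nat) : nat := head 0 (CodeSeq.decode it).
Definition item_prec (it : nat) : nat := head 0 (behead (CodeSeq.decode it)).
Definition item_word (it : nat) : seq nat :=
  behead (behead (CodeSeq.decode it)).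
Definition item_query (n it : nat) : nat := CodeSeq.code (n :: item_word it).
(** The predecessor undoes the shift of answers in [kleene_app], where 0 asks for a longer
    prefix. *)
Definition item_value (p : nat -> nat) (n it : nat) : nat :=
  (p (item_query n it)).-1.

Section search.
(* [D i j k] is the code of a rational number that is [2 ^- k]-close to the
   distance of the points [i] and [j]; [g] enumerates the finite covers. *)
Variables (D : nat -> nat -> nat -> nat) (g : nat -> nat).

(* The word [w] is the shortest prefix on which [p] answers the query [n], and
   every point of the ball has a Cauchy name that extends [w]. *)
Definition good_item (p : nat -> nat) (n it : nat) : bool :=
  ~~ (p (item_query n it) == 0) &&
  all (fun j =>
    (p (CodeSeq.code (n :: mkseq (nth 0 (item_word it)) j)) == 0) &&
    qle (qadd (D (center_of (item_ball it)) (nth 0 (item_word it) j)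
                 (item_prec it))
              (qadd (qexp2V (item_prec it)) (radius_of (item_ball it))))
        (qexp2V j.+1))
    (mkseq id (size (item_word it))).

(** The number [t] codes a stage [s] followed by items. Matching the list of their balls with [g s]
    guarantees that the balls cover the space. *)
Definition good_cover (p : nat -> nat) (n t : nat) : bool :=
  (g (head 0 (CodeSeq.decode t)) ==
     CodeSeq.code (map item_ball (behead (CodeSeq.decode t)))) &&
  all (good_item p n) (behead (CodeSeq.decode t)).

(** The fold starts from the value of the first item, so that no foreign default enters the maximum
    of a nonempty list. *)
Definition cover_value (p : nat -> nat) (n t : nat) : nat :=
  foldr (fun it z => qmax (item_value p n it) z)
    (item_value p n (head 0 (behead (CodeSeq.decode t))))
    (behead (CodeSeq.decode t)).

Hypothesis D_cpt : exists e, forall o i j k,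
  prog_eval o e [:: i; j; k] (D i j k).
Hypothesis g_cpt : exists e, forall o n, prog_eval o e [:: n] (g n).

Section computability.
Variable P : set (nat -> nat).
Context {T : Type} {eT : encoding T}.
Implicit Types F G H : (nat -> nat) -> T -> nat.

Lemma cpt_D F G H :
  cpt P F -> cpt P G -> cpt P H -> cpt P (fun o x => D (F o x) (G o x) (H o x)).
Proof.
case: D_cpt => e eD [f fF] [h hG] [k kH].
exists (Comp e [:: f; h; k]) => o Po x.
exact: eval_comp3 (fF _ Po x) (hG _ Po x) (kH _ Po x) (eD _ _ _ _).
Qed.

Lemma cpt_g F : cpt P F -> cpt P (fun o x => g (F o x)).
Proof.
case: g_cpt => e eg [f fF]; exists (Comp e [:: f]) => o Po x.
exact: eval_comp1 (fF _ Po x) (eg _ _).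
Qed.

Lemma cpt_item_query F G :
  cpt P F -> cpt P G -> cpt P (fun o x => item_query (F o x) (G o x)).
Proof. by move=> Fc Gc; rewrite /item_query /item_word; cpt_tac. Qed.

Lemma cpt_item_value F G :
  cpt P F -> cpt P G -> cpt P (fun o x => item_value o (F o x) (G o x)).
Proof.
move=> Fc Gc; apply: cpt_predn; apply: cpt_oracle; exact: cpt_item_query.
Qed.

End computability.

Lemma cpt_good_item P : cpt P (fun o (x : nat * nat) => good_item o x.1 x.2).
Proof.
rewrite /good_item /radius_of /center_of /item_word /item_ball /item_prec.
apply: cpt_andb.
  by apply: cpt_negb; apply: cpt_eqn; cpt_tac; apply: cpt_item_query; cpt_tac.
apply: cpt_all; last by apply: cpt_mkseq; [|apply: cpt_size]; cpt_tac.
apply: cpt_andb.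
  apply: cpt_eqn; last by cpt_tac.
  apply: cpt_oracle; apply: cpt_code; apply: cpt_cons; first by cpt_tac.
  apply: cpt_mkseq; last by cpt_tac.
  by apply: cpt_nth; cpt_tac.
apply: cpt_qle; last by apply: cpt_qexp2V; cpt_tac.
apply: cpt_qadd.
  apply: cpt_D; last by cpt_tac.
    by apply: cpt_nth; cpt_tac.
  by apply: cpt_nth; cpt_tac.
apply: cpt_qadd; first by apply: cpt_qexp2V; cpt_tac.
by apply: cpt_qmk; [apply: cpt_succ|apply: cpt_cst|apply: cpt_succ];
  apply: cpt_nth; cpt_tac.
Qed.

Lemma cpt_good_cover P : cpt P (fun o (x : nat * nat) => good_cover o x.1 x.2).
Proof.
rewrite /good_cover; apply: cpt_andb.
  apply: cpt_eqn; first by apply: cpt_g; cpt_tac.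
  apply: cpt_code; apply: cpt_map; last by cpt_tac.
  by rewrite /item_ball; cpt_tac.
apply: cpt_all; last by cpt_tac.
apply: (cpt_comp (f := fun o (x : nat * nat) => good_item o x.1 x.2)
  (F := fun o (x : nat * nat * nat) => (x.1.1, x.2))).
  exact: cpt_good_item.
by cpt_tac.
Qed.

Lemma cpt_cover_value P :
  cpt P (fun o (x : nat * nat) => cover_value o x.1 x.2).
Proof.
rewrite /cover_value; apply: cpt_foldr; last by cpt_tac.
  by apply: cpt_qmax; [apply: cpt_item_value|]; cpt_tac.
by apply: cpt_item_value; cpt_tac.
Qed.

End search.

(** * Approximating the maximum value *)

(** The point [x0] turns [T] into a pointed space, to which [compact_cover] applies. *)
Lemma compact_cover_point (T : topologicalType) (x0 : T) :
  compact = @cover_compact T.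
Proof.
pose T' : ptopologicalType :=
  HB.pack (T : Type) (Topological.on T) (isPointed.Build T x0).
exact: (compact_cover T').
Qed.

Section maximum_value.
Context {R : realType} (X : computableMetric R).
Local Open Scope classical_set_scope.
Local Open Scope ring_scope.
Notation a := (cms_seq X).
Notation nu := (nu_rat R).

Variables (D : nat -> nat -> nat -> nat) (g : nat -> nat).
Hypothesis D_approx : forall i j k,
  `|mdist (a i) (a j) - nu (D i j k)| <= 2 ^- k.

Lemma coded_ballE b : coded_ball X b =
  [set x | mdist (a (center_of b)) x < nu (radius_of b)].
Proof.
rewrite /coded_ball ballEmdist /radius_of nu_qmk// subr0.
by [].
Qed.

Lemma open_coded_ball b : open (coded_ball X b).
Proof.
rewrite coded_ballE openE => x /= cx.
apply/metricType_numDomainType.nbhs_mdistP.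
exists (nu (radius_of b) - mdist (a (center_of b)) x) => /=.
  by rewrite subr_gt0.
move=> y /= xy; rewrite (le_lt_trans (metric_triangle _ x _))//.
by rewrite addrC -ltrBrDr.
Qed.

Lemma coded_ball_center b : coded_ball X b (a (center_of b)).
Proof.
by rewrite coded_ballE /= mdistxx nu_qmk// subr0 divr_gt0// ltr0n.
Qed.

Section one_function.
Variables (p : nat -> nat) (f : continuousType X R^o).
Hypothesis pf : cont_name p f.

(** A point of the ball has a Cauchy name that begins with the word of the item. On this name [p]
    answers the query [n] after exactly that word, so the answer is entry [n] of a name of [f x]. *)
Lemma good_item_sound n it x : good_item D p n it ->
  coded_ball X (item_ball it) x -> `|f x - nu (item_value p n it)| <= 2 ^- n.
Proof.
rewrite coded_ballE /good_item => /andP[pn /allP wP] /= cx.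
set w := item_word it in wP *; set c := center_of _ in wP cx.
(* Triangle inequality through the centre: the certified bound contains the approximate distance,
   its error [2 ^- k] (with [k] the precision of the item) and the radius. *)
have wx j : (j < size w)%N -> mdist (a (nth 0%N w j)) x <= 2 ^- j.+1.
  move=> jw; have /wP/andP[_] : j \in mkseq id (size w).
    by apply/mapP; exists j => //; rewrite mem_iota.
  rewrite (qleE R) !nu_qadd !nu_qexp2V; apply: le_trans.
  rewrite metric_sym (le_trans (metric_triangle _ (a c) _))//.
  rewrite metric_sym addrC addrA lerD ?(ltW cx)//.
  rewrite -lerBlDl; exact: le_trans (ler_norm _) (D_approx _ _ _).
have [q' q'x] := choice (fun i =>
  dense_mdist (@cms_dense R X) x (exp2V_gt0 i.+1)).
(* Beyond the word, the name continues with arbitrary close points of the dense sequence. *)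
pose q i := if (i < size w)%N then nth 0%N w i else q' i.
have qx : cauchy_name a q x.
  apply: cauchy_name_approx => i; rewrite /q; case: ifPn => [/wx//|_].
  exact/ltW/q'x.
have [r pqr rx] := pf qx.
have qw j : (j <= size w)%N -> mkseq q j = mkseq (nth 0%N w) j.
  move=> jw; apply: (@eq_from_nth _ 0%N); rewrite !size_mkseq// => i ij.
  by rewrite !nth_mkseq// /q (leq_trans ij jw).
have [m [mr ml]] := pqr n.
have rn : r n = item_value p n it.
  have [mw|wm|mw] := ltngtP m (size w).
  - have /wP/andP[/eqP] : m \in mkseq id (size w).
      by apply/mapP; exists m => //; rewrite mem_iota.
    by rewrite -qw ?(ltnW mw)// mr.
  - by move: pn; rewrite /item_query -/w -(mkseq_nth 0%N w) -qw// ml.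
  - by rewrite /item_value /item_query -/w -(mkseq_nth 0%N w) -qw// -mw mr.
rewrite -rn; exact: (cauchy_name_dist n rx).
Qed.

(** Take a name of [x] whose entries satisfy the strict bounds [< 2 ^- i.+1]. The finitely many
    entries that [p] reads leave some slack, and a sufficiently small ball near [x] with high
    precision fits into it. *)
Lemma good_item_exists n x :
  exists2 it, good_item D p n it & coded_ball X (item_ball it) x.
Proof.
have [q qx] := choice (fun i =>
  dense_mdist (@cms_dense R X) x (exp2V_gt0 i.+1)).
have qname : cauchy_name a q x by apply: cauchy_name_approx => i; exact/ltW/qx.
have [r pqr _] := pf qname; have [m [mr ml]] := pqr n.
(* The four copies of [2 ^- k] pay for the error of [D], the precision added in the test, the
   radius, and the distance from [x] to the centre. *)
have [k kP] : exists k, forall j, (j < m)%N ->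
    mdist (a (q j)) x + (2 ^- k + 2 ^- k + (2 ^- k + 2 ^- k)) <= 2 ^- j.+1.
  elim: (m) => [|m' [k kP]]; first by exists 0%N.
  have [|k' k'P] := @exp2V_lt R (2 ^- m'.+1 - mdist (a (q m')) x).
    by rewrite subr_gt0.
  (* Four copies of [2 ^- k'.+2] make [2 ^- k'], which is below the slack of the new entry; the
     maximum keeps the earlier bounds. *)
  exists (maxn k k'.+2) => j; rewrite ltnS leq_eqVlt => /predU1P[->|jm].
    rewrite -lerBrDl; apply: le_trans (ltW k'P).
    rewrite -(exp2V_half k') -(exp2V_half k'.+1).
    by rewrite !lerD// exp2V_le// leq_maxr.
  apply: le_trans (kP j jm); rewrite lerD2l.
  by rewrite !lerD// exp2V_le// leq_maxl.
have [c cx] := dense_mdist (@cms_dense R X) x (exp2V_gt0 k).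
(* Numerator and denominator are stored less one, so this ball has radius [2 ^- k]. *)
pose b := CodeSeq.code [:: c; 0; (2 ^ k).-1]%N.
have bE : center_of b = c by rewrite /center_of CodeSeq.codeK.
have bR : nu (radius_of b) = 2 ^- k.
  rewrite /radius_of CodeSeq.codeK /= prednK ?expn_gt0//.
  exact: nu_qexp2V.
pose it := CodeSeq.code [:: b, k & mkseq q m].
have itb : item_ball it = b by rewrite /item_ball CodeSeq.codeK.
have itk : item_prec it = k by rewrite /item_prec CodeSeq.codeK.
have itw : item_word it = mkseq q m by rewrite /item_word CodeSeq.codeK.
exists it; last by rewrite coded_ballE /= itb bE bR.
rewrite /good_item /item_query itw mr /= itb itk bE size_mkseq.
apply/allP => j; rewrite /mkseq map_id mem_iota /= add0n => jm.
have -> : [seq nth 0%N [seq q i | i <- iota 0 m] i | i <- iota 0 j] = mkseq q j.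
  apply: (@eq_from_nth _ 0%N); rewrite !size_mkseq// => i ij.
  by rewrite !nth_mkseq// (ltn_trans ij jm).
rewrite ml//= -/(mkseq q m) nth_mkseq// (qleE R) !nu_qadd !nu_qexp2V bR.
apply: le_trans (kP j jm).
have := D_approx c (q j) k; rewrite distrC => /(le_trans (ler_norm _)).
have := metric_triangle (a c) x (a (q j)); rewrite (metric_sym x).
move: cx; set e := 2 ^- k; lra.
Qed.

(** The balls of good items form an open cover. A finite subcover is a coded cover, hence equals
    [g s] for some [s], and [s] followed by its items is the required code. *)
Lemma good_cover_exists n : compact [set: X] -> coded_covers X `<=` range g ->
  exists t, good_cover D g p n t.
Proof.
rewrite (compact_cover_point (a 0%N)) => /(_ nat [set it | good_item D p n it]
  (fun it => coded_ball X (item_ball it))) + cg.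
case=> [it _|x _|E Egood Ecover].
- exact: open_coded_ball.
- by have [it] := good_item_exists n x; exists it.
pose items := finmap.enum_fset E.
have /cg[s _ sE] : coded_covers X (CodeSeq.code (map item_ball items)).
  move=> x; have [//|it /= itE itx] := Ecover x.
  by exists (item_ball it); rewrite ?CodeSeq.codeK ?map_f.
exists (CodeSeq.code (s :: items)).
rewrite /good_cover CodeSeq.codeK /= sE eqxx.
by apply/allP => it /Egood; rewrite inE.
Qed.

(** An item whose ball contains a maximum point shows that [m] exceeds the largest value by at most
    [2 ^- n]. At the centre of an item with the largest value, [f] is at most [m], which gives the
    other estimate. *)
Lemma good_cover_sound n t m : range g `<=` coded_covers X ->
  good_cover D g p n t -> is_maximum (range f) m ->
  `|m - nu (cover_value p n t)| <= 2 ^- n.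
Proof.
move=> gc /andP[/eqP gE /allP items_good] [[x0 _ fx0] fm].
rewrite /cover_value; set items := behead _ in gE items_good *.
have [it items_it itx0] : exists2 it,
    it \in items & coded_ball X (item_ball it) x0.
  have [b] := gc _ (imageT g (head 0%N (CodeSeq.decode t))) x0.
  by rewrite gE CodeSeq.codeK => /mapP[it itt ->]; exists it.
(* The list is nonempty because some ball contains [x0], so the initial value of the fold belongs to
   an item. *)
have hd : head 0%N items \in items.
  by case: (items) items_it => // ? ?; rewrite mem_head.
have [ub ex] := nu_foldr_qmax R (item_value p n)
  (item_value p n (head 0%N items)) items.
set v := nu _ in ub ex *.
have [it' it'P vE] : exists2 it', it' \in items & v = nu (item_value p n it').
  by case: ex => [|//]; exists (head 0%N items).
have := good_item_sound (items_good _ it'P) (coded_ball_center _).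
rewrite -vE; have := ub _ items_it.
have := fm _ (imageT f (a (center_of (item_ball it')))).
have := good_item_sound (items_good _ items_it) itx0; rewrite fx0.
rewrite !ler_norml; set e := 2 ^- n; lra.
Qed.

End one_function.

Hypothesis D_cpt : exists e, forall o i j k,
  prog_eval o e [:: i; j; k] (D i j k).
Hypothesis g_cpt : exists e, forall o n, prog_eval o e [:: n] (g n).
Hypothesis X_cpt : compact [set: X].
Hypothesis g_covers : coded_covers X = range g.

(** Unbounded search finds a good cover for each precision; oracles are restricted to names of
    continuous functions, for which it terminates. *)
Lemma cpt_maximum_value :
  exists2 M, cpt [set p | exists f : continuousType X R^o, cont_name p f] M &
    forall p (f : continuousType X R^o) m, cont_name p f ->
      is_maximum (range f) m -> forall n : nat, `|m - nu (M p n)| <= 2 ^- n.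
Proof.
set P := [set p | _].
have [|t tcpt tP] := cpt_mu (cpt_good_cover D_cpt g_cpt P).
  move=> p [f pf] n; apply: good_cover_exists pf n X_cpt _ => //.
  by rewrite g_covers.
exists (fun o n => cover_value o n (t o n)).
  apply: (cpt_comp (F := fun o n => (n, t o n)) (cpt_cover_value P)).
  by cpt_tac.
move=> p f m pf fm n; apply: (good_cover_sound pf _ _ fm) => //.
  by rewrite g_covers.
by apply: tP; exists f.
Qed.

End maximum_value.

(** * The two reductions *)

Section reductions.
Local Open Scope classical_set_scope.
Local Open Scope ring_scope.

Lemma cpt_computes P F : cpt P F ->
  exists e, forall p, P p -> computes e p (F p).
Proof. by move=> [e eF]; exists e => p Pp n; exact: eF. Qed.

(** For reductions that only translate the instance. [H] is the projection to the solution, whose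
    name sits at the odd positions of the name of the pair. *)
Lemma weihrauch_le_pre (A B C : repSpace) (f : Defs.mfun A B)
    (g : Defs.mfun C B) (K : Defs.mfun A C) : mcomputable K ->
  (forall x, mdom f x -> [/\ K x !=set0, K x `<=` mdom g &
     forall y, K x y -> g y `<=` f x]) ->
  weihrauch_le f g.
Proof.
move=> Kc Kfg; exists (fun z : A * B => [set z.2]), K; split => //.
  have [|e eP] := @cpt_computes setT (fun o n => o (n + n).+1).
    by cpt_tac.
  exists e => p z [_ pz] _; exists (fun n => p n.*2.+1).
  split; last by exists z.2.
  by have := eP p I; under eq_fun do rewrite addnn.
move=> x /Kfg[[y Kxy] Kg gf]; split; last first.
  by move=> _ [_ [[z1 z2] [/= _ [_ [y' Kxy' gy']]]] ->]; exact: gf gy'.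
have [z gyz] := Kg _ Kxy; exists z; split; first by move=> w _; exists w.2.
by exists (x, z) => //; split=> //; split=> //; exists y.
Qed.

(** Post-processing on function names: the query [n] is forwarded as [h n] and the answer is
    transformed by [F n]. Keeping 0 as 0 means that the same prefixes are read. *)
Lemma kleene_app_map (h : nat -> nat) (F : nat -> nat -> nat) p q r :
  kleene_app p q r ->
  kleene_app (fun c =>
    let v := p (CodeSeq.code ((h (head 0%N (CodeSeq.decode c))) ::
                              behead (CodeSeq.decode c))) in
    if v == 0%N then 0%N else (F (head 0%N (CodeSeq.decode c)) v.-1).+1)
    q (fun n => F n (r (h n))).
Proof.
move=> pqr n; have [m [mr ml]] := pqr (h n).
exists m; split=> [|k km]; cbv beta zeta.
  by rewrite CodeSeq.codeK [head _ _]/= [behead _]/= mr.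
by rewrite CodeSeq.codeK [head _ _]/= [behead _]/= ml.
Qed.

(** * The instance translations [f - max f] and [- |f|] *)

Context {R : realType} (X : computableMetric R).

Definition minus_maximum : Defs.mfun (cont_space X) (cont_space X) :=
  fun f => [set h | exists2 m, is_maximum (range (f : continuousType X R^o)) m &
    forall x, (h : continuousType X R^o) x = (f : continuousType X R^o) x - m].

Definition minus_abs : Defs.mfun (cont_space X) (cont_space X) :=
  fun f => [set h | forall x,
    (h : continuousType X R^o) x = - `|(f : continuousType X R^o) x|].

Lemma real_name_approx r (y : R) :
  (forall n, `|y - nu_rat R (r n)| <= 2 ^- n.+1) ->
  is_name (r := real_space R) r y.
Proof. by move=> ry; apply: cauchy_name_approx => n; exact: ry. Qed.

Lemma real_name_dist r (y : R) n : is_name (r := real_space R) r y ->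
  `|y - nu_rat R (r n)| <= 2 ^- n.
Proof. by move=> ry; exact: (cauchy_name_dist n ry). Qed.

(** The map [y |-> - |y|] does not increase distances, so asking [p] the query [n + 1] gives the
    precision that [real_name_approx] requires. *)
Lemma minus_abs_computable : mcomputable minus_abs.
Proof.
have [|e eP] := @cpt_computes setT (fun o c =>
    let v := o (CodeSeq.code ((head 0%N (CodeSeq.decode c)).+1 ::
                              behead (CodeSeq.decode c))) in
    if v == 0%N then 0%N else (qoppabs v.-1).+1).
  by cbv zeta; apply: cpt_if; cpt_tac; apply: cpt_qoppabs; cpt_tac.
exists e => p f pf [h hE]; eexists; split; first exact: eP.
exists h => // q x qx; have [r pqr rx] := pf _ _ qx.
exists (fun n => qoppabs (r n.+1)).
  exact: (kleene_app_map S (fun=> qoppabs) pqr).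
apply: real_name_approx => n; rewrite hE nu_qoppabs.
apply: le_trans (real_name_dist n.+1 rx).
by rewrite opprK addrC distrC ler_dist_dist.
Qed.

(** Excludes the empty case of [comp_enumerable]: finitely many balls of radius 1 cover the
    space. *)
Lemma coded_covers_nonempty : compact [set: X] -> coded_covers X !=set0.
Proof.
pose b c := CodeSeq.code [:: c; 0; 0]%N.
rewrite (compact_cover_point (cms_seq X 0%N)).
move=> /(_ nat setT (fun c => coded_ball X (b c)))[c _|x _|E _ Ecover].
- exact: open_coded_ball.
- have [c cx] := dense_mdist (@cms_dense R X) x ltr01.
  exists c => //; rewrite coded_ballE /= nu_qmk// /b /center_of CodeSeq.codeK/=.
  by rewrite subr0 divr1.
exists (CodeSeq.code (map b (finmap.enum_fset E))) => x.
have [//|c /= cE cx] := Ecover x.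
by exists (b c); rewrite ?CodeSeq.codeK ?map_f.
Qed.

Lemma minus_maximum_computable :
  computably_compact X -> mcomputable minus_maximum.
Proof.
move=> [X_cpt [c0|[g /computable_fun_eval g_cpt cg]]].
  by have [n] := coded_covers_nonempty X_cpt; rewrite c0.
have [D D_cpt D_approx] : exists2 D,
    exists e, forall o i j k, prog_eval o e [:: i; j; k] (D i j k) &
    forall i j k,
      `|mdist (cms_seq X i) (cms_seq X j) - nu_rat R (D i j k)| <= 2 ^- k.
  have [e eD] := cms_computable X.
  (* Choosing an output of the distance program for each argument turns it into a function [D] which
     that program computes. *)
  have /choice[D DP] (ijk : nat * nat * nat) : exists y,
      prog_eval (fun=> 0%N) e [:: ijk.1.1; ijk.1.2; ijk.2] y /\
      `|mdist (cms_seq X ijk.1.1) (cms_seq X ijk.1.2) - nu_rat R y|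
        <= 2 ^- ijk.2.
    by have [y] := eD ijk.1.1 ijk.1.2 ijk.2; exists y.
  exists (fun i j k => D (i, j, k)).
    exists (forget_oracle e) => o i j k; apply: eval_forget_oracle.
    by have [] := DP (i, j, k).
  by move=> i j k; have [] := DP (i, j, k).
have [M M_cpt MP] := cpt_maximum_value D_approx D_cpt g_cpt X_cpt cg.
(* The errors of [f] and of its maximum are each at most [2 ^- n.+2] and add up to [2 ^- n.+1];
   hence the shift by two. *)
have [|e eP] := @cpt_computes
  [set p | exists f : continuousType X R^o, cont_name p f]
  (fun o c =>
    let v := o (CodeSeq.code ((head 0%N (CodeSeq.decode c)).+2 ::
                              behead (CodeSeq.decode c))) in
    if v == 0%N then 0%N
    else (qadd v.-1 (qopp (M o (head 0%N (CodeSeq.decode c)).+2))).+1).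
  cbv zeta; apply: cpt_if; cpt_tac; apply: cpt_qadd; cpt_tac; apply: cpt_qopp.
  by apply: (cpt_comp M_cpt); cpt_tac.
exists e => p f pf [h [m fm hE]]; eexists; split; first by apply: eP; exists f.
exists h; last by exists m.
move=> q x qx; have [r pqr rx] := pf _ _ qx.
exists (fun n => qadd (r n.+2) (qopp (M p n.+2))).
  exact: (kleene_app_map (fun n => n.+2)
    (fun n v => qadd v (qopp (M p n.+2))) pqr).
apply: real_name_approx => n; rewrite hE nu_qadd nu_qopp.
have subACA (u v w z : R) : u - v - (w - z) = (u - w) - (v - z) by lra.
rewrite subACA.
rewrite (le_trans (ler_normB _ _))// -exp2V_half lerD//; last exact: MP pf fm _.
exact: real_name_dist.
Qed.

(** The zeros of [f - max f] are exactly the points where [f] is maximal; a given maximum point [x]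
    supplies the maximum [f x]. *)
Lemma MAX_le_ZERO : computably_compact X -> weihrauch_le (@MAX R X) (@ZERO R X).
Proof.
move=> X_cpt.
apply: (weihrauch_le_pre (minus_maximum_computable X_cpt)) => f [x fx]; split.
- have fc : continuous ((fun y => f y - f x) : X -> R^o).
    by move=> y; apply: cvgB; [exact: cts_fun|exact: cvg_cst].
  by exists (mkcts fc : continuousType X R^o); exists (f x).
- move=> h [m [[y _ <-] _] hE]; exists y.
  by rewrite /ZERO /= hE subrr.
- move=> h [m fm hE] y; rewrite /ZERO /= hE => /eqP.
  by rewrite subr_eq0 => /eqP fy; rewrite /MAX /= fy.
Qed.

(** If [f] has a zero, then [- |f|] has maximum 0, attained exactly at the zeros of [f]. *)
Lemma ZERO_le_MAX : weihrauch_le (@ZERO R X) (@MAX R X).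
Proof.
apply: (weihrauch_le_pre minus_abs_computable) => f [x fx0].
have {}fx0 : f x = 0 := fx0.
split.
- have fc : continuous ((fun y => - `|f y|) : X -> R^o).
    by move=> y; apply: cvgN; apply: cvg_norm; exact: cts_fun.
  by exists (mkcts fc : continuousType X R^o).
- move=> h hE; exists x; split; first by exists x.
  by move=> _ [z _ <-]; rewrite !hE fx0 normr0 oppr0 oppr_le0.
- move=> h hE y [_ ub]; have := ub _ (imageT h x).
  by rewrite !hE fx0 normr0 oppr0 oppr_ge0 normr_le0 => /eqP.
Qed.

End reductions.

Theorem theorem4p2 (R : realType) (X : computableMetric R)
  (X_cpt : computably_compact X) : weihrauch_equiv (@MAX R X) (@ZERO R X).
Proof. by split; [exact: MAX_le_ZERO|exact: ZERO_le_MAX]. Qed.
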